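(* Let $q\ge 2$, $n\ge 2$ and $A=\mathbb{Z}_q$. Every transformation $f:A^n\to A^n$ can be computed by a program which only consists of transpositions $(u,v)$ with $u,v\in A^n$ and $v=u+e^i$ for some $1\le i\le n$, and of the assignment $(e^0\to e^1)$. That is, every transformation of $A^n$ is a finite composition (the empty composition being the identity) of such maps, each of which is an instruction.
   Context: A transformation of $A^n$ is a map $f=(f_1,\dots,f_n):A^n\to A^n$; its coordinate function $f_i:A^n\to A$ is trivial if $f_i(x)=x_i$ for all $x$. An instruction is a transformation of $A^n$ with at most one nontrivial coordinate function. A program of length $L$ computing $f$ is a sequence of instructions $g^1,\dots,g^L$ with $f=g^L\circ\cdots\circ g^1$. For $u,v\in A^n$, the transposition $(u,v)$ is the permutation of $A^n$ which maps $u$ to $v$, $v$ to $u$ and fixes every other element; the assignment $(u\to v)$ is the transformation of $A^n$ which maps $u$ to $v$ and fixes every other element. $e^0\in A^n$ is the all-zero tuple and, for $1\le k\le n$, $e^k\in A^n$ is the $k$-th unit tuple ($e^k_i=1$ if $i=k$ and $0$ otherwise). Addition in $A^n$ is componentwise modulo $q$. *)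

(* Defs.v *)
From mathcomp Require Import all_boot all_order all_algebra all_fingroup.

Set Implicit Arguments.
Unset Strict Implicit.
Unset Printing Implicit Defensive.

Import GRing.Theory.
Local Open Scope ring_scope.

(* A^n with A = Z/qZ, as row vectors, so that + is componentwise addition
   modulo q. 'Z_q is Z/qZ only for q >= 2. *)
Notation state q n := 'rV['Z_q]_n.

(* Since A^n is finite, its transformations are finite functions, for which
   = is extensional equality. *)
Notation transformation q n := {ffun state q n -> state q n}.

(* Coordinates are numbered from 1 in e^k and from 0 in 'I_n; e^0 is the
   all-zero tuple. *)
Definition unit_tuple (q n k : nat) : state q n :=
  \row_(i < n) (i.+1 == k)%:R.

Definition trivial_coord (q n : nat) (f : transformation q n) (i : 'I_n) :
    bool :=
  [forall x, f x 0 i == x 0 i].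

Definition instruction (q n : nat) (f : transformation q n) : bool :=
  (#|[set i : 'I_n | ~~ trivial_coord f i]| <= 1)%N.

(* [:: g1; ...; gL] is sent to gL \o ... \o g1, and [::] to the identity. *)
Definition composition (q n : nat) (p : seq (transformation q n)) :
    transformation q n :=
  foldl (fun h g : transformation q n => [ffun x => g (h x)])
        [ffun x => x] p.

Definition computes (q n : nat) (p : seq (transformation q n))
    (f : transformation q n) : Prop :=
  all (@instruction q n) p /\ f = composition p.

Definition transposition (q n : nat) (u v : state q n) : transformation q n :=
  [ffun x => tperm u v x].

Definition assignment (q n : nat) (u v : state q n) : transformation q n :=
  [ffun x => if x == u then v else x].

Definition generator (q n : nat) (g : transformation q n) : Prop :=
  (exists (u v : state q n) (i : nat),
     [/\ (1 <= i <= n)%N, v = u + unit_tuple q n i & g = transposition u v])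
  \/ g = assignment (unit_tuple q n 0) (unit_tuple q n 1).

(* Main.v *)
Require Import Defs.
From mathcomp Require Import all_boot all_order all_algebra all_fingroup.

(** The relation "(u, v) is generated" on states is an equivalence relation
    joining every state to its translates by the unit tuples, hence by all
    states; so every transposition, and thus every permutation, is generated.
    Conjugating the one available assignment by permutations gives all
    assignments. Finally, if f is not injective, say f x = f y with x <> y, and
    z is not in its image, then f is the assignment (z -> f x) applied after
    the map g that agrees with f except that g x = z; the image of g is larger
    than that of f, so one concludes by induction on the size of the complement
    of the image. *)

Import GRing.Theory.
Local Open Scope ring_scope.

Definition comp_closed {T : finType} (S : {ffun T -> T} -> Prop) : Prop :=
  S [ffun x => x] /\ (forall f g, S f -> S g -> S [ffun x => g (f x)]).

(** When [w] differs from [u] and [v], conjugating [(v w)] by [(u v)] gives [(u w)]. When [u = w],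
    the identity arises as the square of [(v w)]. *)
Lemma comp_closed_tperm_trans {T : finType} {S : {ffun T -> T} -> Prop}
    (u v w : T) : comp_closed S ->
  S [ffun x => tperm u v x] -> S [ffun x => tperm v w x] ->
  S [ffun x => tperm u w x].
Proof.
move=> [_ Sc] Suv Svw.
have [->|neq_uw] := eqVneq u w.
  have := Sc _ _ Svw Svw; congr S; apply/ffunP => x.
  by rewrite !ffunE tpermK tperm1 perm1.
have [eq_vw|neq_vw] := eqVneq v w; first by rewrite -eq_vw.
have := Sc _ _ (Sc _ _ Suv Svw) Suv; congr S; apply/ffunP => x.
have -> : tperm u w = (tperm v w ^ tperm u v)%g.
  by rewrite tpermJ tpermR tpermD // eq_sym.
by rewrite conjgE tpermV !ffunE !permM.
Qed.

Lemma comp_closed_perm {T : finType} {S : {ffun T -> T} -> Prop} :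
  comp_closed S -> (forall u v, S [ffun x => tperm u v x]) ->
  forall s : {perm T}, S [ffun x => s x].
Proof.
move=> [S1 Sc] St s; have [ts -> _] := prod_tpermP s.
elim: ts => [|t ts IH].
  by rewrite big_nil; congr S: S1; apply/ffunP => x; rewrite !ffunE perm1.
have := Sc _ _ (St t.1 t.2) IH; congr S; apply/ffunP => x.
by rewrite big_cons !ffunE permM.
Qed.

Lemma comp_closed_assign {T : finType} {S : {ffun T -> T} -> Prop} (a b : T) :
  comp_closed S -> (forall s : {perm T}, S [ffun x => s x]) ->
  a != b -> S [ffun x => if x == a then b else x] ->
  forall u v, u != v -> S [ffun x => if x == u then v else x].
Proof.
move=> [_ Sc] Sp neq_ab Sab u v neq_uv.
(* The first factor sends [u] to [a]; the second brings the image of [v] to [b] and fixes [a], which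
   is neither that image nor [b]. Hence [s] conjugates [(a -> b)] into [(u -> v)]. *)
pose s := (tperm u a * tperm (tperm u a v) b)%g.
have sv : s v = b by rewrite permM tpermL.
have su : s u = a.
  rewrite permM tpermL tpermD 1?eq_sym //.
  by rewrite -{1}(tpermL u a) (inj_eq perm_inj).
have := Sc _ _ (Sc _ _ (Sp s) Sab) (Sp s^-1%g); congr S; apply/ffunP => x.
rewrite !ffunE -su (inj_eq perm_inj) -sv.
by case: ifP => _; rewrite permK.
Qed.

Lemma comp_closed_full {T : finType} {S : {ffun T -> T} -> Prop} :
  comp_closed S -> (forall s : {perm T}, S [ffun x => s x]) ->
  (forall u v, u != v -> S [ffun x => if x == u then v else x]) ->
  forall f, S f.
Proof.
move=> [_ Sc] Sp Sa f.
have [k] := ubnP #|[predC codom f]|; elim: k f => // k IH f ltk.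
have [/injectiveP f_inj|] := boolP (injectiveb f).
  by have := Sp (perm f_inj); congr S; apply/ffunP => x; rewrite ffunE permE.
move=> /injectivePn[x [y neq_xy fxy]].
have [z zNf] : exists z, z \notin codom f.
  apply/existsP; apply: contraT; rewrite negb_exists => /forallP f_onto.
  (* [codom f] lists [#|T|] values; if it covers [T], it has no repetition. *)
  have f_inj : injective f.
    apply/injectiveP/card_uniqP; rewrite size_codom.
    by apply: eq_card => t; rewrite !inE; have := f_onto t; rewrite negbK.
  by rewrite (f_inj _ _ fxy) eqxx in neq_xy.
pose g : {ffun T -> T} := [ffun w => if w == x then z else f w].
have Sg : S g.
  apply: IH; rewrite -ltnS; apply: leq_trans ltk; apply: proper_card.
  (* No value is lost, since [g y = f x]; the value [z] is gained. *)
  apply/properP; split.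
    apply/subsetP => t; rewrite !inE; apply: contra => /codomP[w ->].
    have [->|neq_wx] := eqVneq w x.
      by apply/codomP; exists y; rewrite ffunE eq_sym (negPf neq_xy).
    by apply/codomP; exists w; rewrite ffunE (negPf neq_wx).
  exists z; rewrite !inE ?zNf // negbK.
  by apply/codomP; exists x; rewrite ffunE eqxx.
have neq_z w : z != f w by apply: contraNneq zNf => ->; apply: codom_f.
have := Sc _ _ Sg (Sa _ _ (neq_z x)); congr S; apply/ffunP => w.
rewrite !ffunE; have [->|_] := eqVneq w x; first by rewrite eqxx.
by rewrite eq_sym (negPf (neq_z w)).
Qed.

Lemma instructionP {q n : nat} (f : transformation q n) (i : 'I_n) :
  (forall x (j : 'I_n), j != i -> f x 0 j = x 0 j) -> instruction f.
Proof.
move=> f_triv; rewrite /instruction -(cards1 i) subset_leq_card //.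
apply/subsetP => j; rewrite !inE; apply: contraR => neq_ji.
by apply/forallP => x; rewrite f_triv.
Qed.

Lemma generator_instruction {q n : nat} (g : transformation q n) :
  (0 < n)%N -> generator g -> instruction g.
Proof.
move=> n_gt0 [[u [v [[|i] [//= lt_in def_v ->]]]]|->].
  apply: (@instructionP _ _ _ (Ordinal lt_in)) => x j neq_ji.
  have uv_j : v 0 j = u 0 j.
    rewrite def_v !mxE eqSS -[i]/(val (Ordinal lt_in)) val_eqE.
    by rewrite (negPf neq_ji) addr0.
  by rewrite ffunE; case: tpermP => // ->.
apply: (@instructionP _ _ _ (Ordinal n_gt0)) => x j neq_j0.
rewrite ffunE; case: eqP => // ->.
by rewrite !mxE eqSS -[0%N]/(val (Ordinal n_gt0)) val_eqE (negPf neq_j0).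
Qed.

(** The instruction condition of [computes] is left out here; it is restored at the end, since every
    generator is an instruction. *)
Definition generated {q n : nat} (f : transformation q n) : Prop :=
  exists p : seq (transformation q n),
    (forall g, g \in p -> generator g) /\ f = composition p.

Lemma composition_cat {q n : nat} (p1 p2 : seq (transformation q n)) :
  composition (p1 ++ p2) = [ffun x => composition p2 (composition p1 x)].
Proof.
elim/last_ind: p2 => [|p2 g IH].
  by rewrite cats0; apply/ffunP => x; rewrite !ffunE.
rewrite -rcons_cat /composition !foldl_rcons -!/(composition _) IH.
by apply/ffunP => x; rewrite !ffunE.
Qed.

Lemma generated_closed {q n : nat} : comp_closed (@generated q n).
Proof.
split=> [|_ _ [p1 [gen1 ->]] [p2 [gen2 ->]]]; first by exists [::].
exists (p1 ++ p2); split; last by rewrite composition_cat.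
by move=> g; rewrite mem_cat => /orP[/gen1|/gen2].
Qed.

Lemma generator_generated {q n : nat} (g : transformation q n) :
  generator g -> generated g.
Proof.
move=> gen_g; exists [:: g]; split=> [h|]; first by rewrite inE => /eqP->.
by apply/ffunP => x; rewrite !ffunE.
Qed.

(** The coefficients are residues read as natural numbers, so each term is a repeated addition of
    one unit tuple. *)
Lemma state_sum {q n : nat} (x : state q n) :
  x = \sum_(i < n) unit_tuple q n i.+1 *+ x 0 i.
Proof.
apply/rowP => j; rewrite summxE (bigD1 j) //= big1 => [|i neq_ij].
  by rewrite addr0 mulmxnE mxE eqxx natr_Zp.
by rewrite mulmxnE mxE eqSS val_eqE eq_sym (negPf neq_ij) mul0rn.
Qed.

Lemma transposition_generated {q n : nat} (u v : state q n) :
  generated (transposition u v).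
Proof.
(* Quantifying over every base point [u] makes [P] stable under addition: [u], [u + x] and
   [u + x + y] are chained by transitivity. *)
pose P (x : state q n) := forall u, generated (transposition u (u + x)).
have P0 : P 0.
  move=> w; have := (@generated_closed q n).1; congr generated.
  by apply/ffunP => x; rewrite !ffunE addr0 tperm1 perm1.
have PD x y : P x -> P y -> P (x + y).
  move=> Px Py w; rewrite addrA.
  exact: comp_closed_tperm_trans generated_closed (Px w) (Py (w + x)).
suffices Pall x : P x by rewrite -[v](subrKC u); exact: Pall.
rewrite (state_sum x); apply: (big_ind P) => // i _.
elim: (nat_of_ord (x 0 i)) => [|k IH]; rewrite ?mulr0n // mulrS; apply: PD => // w.
apply: generator_generated; left.
by exists w, (w + unit_tuple q n i.+1), i.+1; rewrite /= ltn_ord.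
Qed.

Lemma unit_tuple01 {q n : nat} :
  (0 < n)%N -> unit_tuple q n 0 != unit_tuple q n 1.
Proof.
move=> n_gt0; apply/eqP => /rowP/(_ (Ordinal n_gt0)) /eqP.
by rewrite !mxE eq_sym oner_eq0.
Qed.

Lemma all_generated {q n : nat} (f : transformation q n) :
  (0 < n)%N -> generated f.
Proof.
move=> n_gt0; have clo := @generated_closed q n.
have Sp := comp_closed_perm clo transposition_generated.
apply: (comp_closed_full clo Sp).
apply: (comp_closed_assign _ _ clo Sp (unit_tuple01 n_gt0)).
by apply: generator_generated; right.
Qed.

Local Close Scope ring_scope.

Theorem theorem1 (q n : nat) (hq : 2 <= q) (hn : 2 <= n) :
  (forall g : transformation q n, generator g -> instruction g) /\
  (forall f : transformation q n,
     exists p : seq (transformation q n),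
       (forall g, g \in p -> generator g) /\ computes p f).
Proof.
have n_gt0 := ltnW hn.
split=> [g|f]; first exact: generator_instruction.
have [p [gen_p def_f]] := all_generated f n_gt0.
exists p; split=> //; split=> //.
by apply/allP => g /gen_p; apply: generator_instruction.
Qed.
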